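(* Let $b$ be a locally finite graph over $(X,m)$ and let $q=0$. Let $v:X\to(0,\infty)$ be a strictly positive superharmonic function (i.e. $\mathcal{H}v\ge0$ on $X$) that satisfies the bounded oscillation condition $\sup_{x\sim y}v(x)/v(y)<\infty$, and let $w=\mathcal{H}(v^{1/2})/v^{1/2}$ be the corresponding Hardy weight. Let $f\in C_c(X)$ and let $u$ be either (a) an approximable function $u\in\mathcal{F}$ that is a solution of $\mathcal{H}u=f$ or a positive subsolution (i.e. $u\ge0$ and $\mathcal{H}u\le f$), or (b) a solution $u\in D(H)$ of $\mathcal{H}u=f$. Then for all $\alpha\in(0,1)$ $$u\in\ell^2(X,v^\alpha wm).$$
   Context: $X$ is an infinite countable set, $m:X\to(0,\infty)$, and a graph $b$ over $(X,m)$ is a symmetric function $b:X\times X\to[0,\infty)$ with zero diagonal and $\sum_{y}b(x,y)<\infty$ for all $x$; $x\sim y$ means $b(x,y)>0$; the graph is locally finite if $\#\{y:y\sim x\}<\infty$ for all $x$. $C(X)$ is the space of real functions on $X$, $C_c(X)$ those with finite support. For $f\in C(X)$, $|\nabla f|^2(x)=\frac{1}{2m(x)}\sum_{y}b(x,y)(f(x)-f(y))^2$. $h(\varphi)=\sum_{X}|\nabla\varphi|^2m$ for $\varphi\in C_c(X)$; $h$ is closable in $\ell^2(X,m)$, and $H$ is the self-adjoint operator on $\ell^2(X,m)$ associated with its closure, with domain $D(H)$. $H$ is a restriction of the formal operator $\mathcal{H}f(x)=\frac1{m(x)}\sum_y b(x,y)(f(x)-f(y))$, defined on $\mathcal{F}=\{f\in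 C(X):\sum_y b(x,y)|f(y)|<\infty\ \forall x\in X\}$. A function $u\in\mathcal{F}$ is approximable if there is a sequence $(\varphi_n)$ in $C_c(X)$ with $0\le\varphi_n\nearrow1$ pointwise and $\lim_{n\to\infty}\sum_Xu^2|\nabla\varphi_n|^2m=0$. The function $w$ above is nonnegative and is a Hardy weight, i.e. $h(\varphi)\ge\sum_Xw\varphi^2m$ for all $\varphi\in C_c(X)$ (known). For a weight $\mu\ge0$, $u\in\ell^2(X,\mu)$ means $\sum_Xu^2\mu<\infty$. *)

(* Defs.v *)
From HB Require Import structures.
From mathcomp Require Import all_boot all_order all_algebra.
From mathcomp Require Import all_classical all_reals all_analysis.
Set Implicit Arguments.
Unset Strict Implicit.
Unset Printing Implicit Defensive.
Import Order.TTheory GRing.Theory Num.Theory.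
Import numFieldNormedType.Exports.
Local Open Scope classical_set_scope.
Local Open Scope ring_scope.

Section Graphs.
Context {R : realType} {X : countType}.
Implicit Types (m f g u v phi psi : X -> R) (b : X -> X -> R).

(* Unordered sum over X of a real-valued function; it has its usual meaning
   when F is absolutely summable (the positive and negative parts then have
   finite sums) and is unspecified otherwise. *)
Definition sumX (F : X -> R) : R :=
  fine (\esum_(x in [set: X]) (F^\+ x)%:E)
  - fine (\esum_(x in [set: X]) (F^\- x)%:E).

Record is_graph b : Prop := IsGraph {
  graph_ge0 : forall x y, 0 <= b x y;
  graph_sym : forall x y, b x y = b y x;
  graph_diag : forall x, b x x = 0;
  graph_summable : forall x, (\esum_(y in [set: X]) (b x y)%:E < +oo)%E }.

Definition graph_adj b x y : Prop := 0 < b x y.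

Definition locally_finite b : Prop :=
  forall x, finite_set [set y | graph_adj b x y].

Definition finitely_supported f : Prop := finite_set [set x | f x != 0].

Definition ell2 (mu : X -> R) u : Prop :=
  (\esum_(x in [set: X]) (u x ^+ 2 * mu x)%:E < +oo)%E.

Definition formal_dom b f : Prop :=
  forall x, (\esum_(y in [set: X]) (b x y * `|f y|)%:E < +oo)%E.

Definition formal_op m b f (x : X) : R :=
  (m x)^-1 * sumX (fun y => b x y * (f x - f y)).

Definition superharmonic m b v : Prop :=
  formal_dom b v /\ forall x, 0 <= formal_op m b v x.

Definition solution m b f u : Prop :=
  formal_dom b u /\ forall x, formal_op m b u x = f x.

Definition subsolution m b f u : Prop :=
  formal_dom b u /\ forall x, formal_op m b u x <= f x.

Definition bounded_oscillation b v : Prop :=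
  has_ubound [set r | exists x y, graph_adj b x y /\ r = v x / v y].

Definition hardy_weight m b v (x : X) : R :=
  formal_op m b (fun y => v y `^ 2^-1) x / v x `^ 2^-1.

(* |grad f|^2, possibly +oo when the graph is not locally finite. *)
Definition gradsq m b f (x : X) : \bar R :=
  (((2 * m x)^-1)%:E *
    \esum_(y in [set: X]) (b x y * (f x - f y) ^+ 2)%:E)%E.

Definition approximable m b u : Prop :=
  formal_dom b u /\
  exists phi : nat -> X -> R,
    [/\ forall n, finitely_supported (phi n),
        forall n x, 0 <= phi n x,
        forall x, nondecreasing_seq (fun n => phi n x),
        forall x, (fun n => phi n x) @ \oo --> (1 : R) &
        (fun n => \esum_(x in [set: X])
           ((u x ^+ 2)%:E * gradsq m b (phi n) x * (m x)%:E)%E) @ \oo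
          --> 0%E].

(* The quadratic form h, finite on finitely supported functions. *)
Definition graph_form m b phi : \bar R :=
  \esum_(x in [set: X]) (gradsq m b phi x * (m x)%:E)%E.

(* The symmetric bilinear form associated with h, by polarization. *)
Definition graph_form2 m b phi psi : R :=
  (fine (graph_form m b (phi \+ psi)) - fine (graph_form m b (phi \- psi))) / 4.

(* phi is a form-Cauchy sequence of finitely supported functions converging
   to u in ell^2(X, m). *)
Definition form_approx m b (phi : nat -> X -> R) u : Prop :=
  [/\ forall n, finitely_supported (phi n),
      (fun n => \esum_(x in [set: X]) ((phi n x - u x) ^+ 2 * m x)%:E) @ \oo
        --> 0%E &
      forall e : R, 0 < e -> exists N, forall n k, (N <= n)%N -> (N <= k)%N ->
        (graph_form m b (phi n \- phi k)%R <= e%:E)%E].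

Definition closure_dom m b u : Prop :=
  ell2 m u /\ exists phi : nat -> X -> R, form_approx m b phi u.

(* The closure of h takes the value l at (u, v); since h is closable, l does
   not depend on the approximating sequences. *)
Definition closure_form2 m b u v (l : R) : Prop :=
  exists phi psi : nat -> X -> R,
    [/\ form_approx m b phi u, form_approx m b psi v &
    (fun n => graph_form2 m b (phi n) (psi n)) @ \oo --> l].

(* The graph of the self-adjoint operator H associated with the closure. *)
Definition op_H m b u g : Prop :=
  [/\ closure_dom m b u, ell2 m g &
      forall v, closure_dom m b v ->
        closure_form2 m b u v (sumX (fun x => g x * v x * m x))].

Definition dom_H m b u : Prop := exists g, op_H m b u g.

End Graphs.

(* Main.v *)
Require Import Defs.
From HB Require Import structures.
From mathcomp Require Import all_boot all_order all_algebra.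
From mathcomp Require Import all_classical all_reals all_analysis.
From mathcomp Require Import finmap ring lra.
Set Implicit Arguments.
Unset Strict Implicit.
Unset Printing Implicit Defensive.
Import Order.TTheory GRing.Theory Num.Theory.
Import numFieldNormedType.Exports.
Local Open Scope classical_set_scope.
Local Open Scope ring_scope.

(* Put g = v^(1/2), w = Hg/g and psi = g^alpha. Since g^2 is superharmonic,
   |grad g|^2 <= g^2 w, and the edgewise inequality
   (psi x - psi y)^2 g x g y <= alpha^2 psi x psi y (g x - g y)^2, which is
   sinh (alpha r) <= alpha sinh r in logarithmic coordinates, yields
   1/2 sum_(x, y) b(x, y) u(x) u(y) (psi x - psi y)^2
     <= alpha^2 sum_x w psi^2 u^2 m.
   Testing the Hardy inequality with psi u and using h(psi u) =
   <Hu, psi^2 u> + 1/2 sum_(x, y) b u u (psi x - psi y)^2 gives, formally,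
   (1 - alpha^2) sum w psi^2 u^2 m <= sum f u psi^2 m. To make this rigorous,
   replace v by the bounded superharmonic function min(v, K), which changes
   neither v nor w on a given finite set once K is large; then cut off with the
   functions phi_n in case (a), or replace u by form approximants of finite
   support in case (b). *)

(** * Elementary inequalities for exponentials and powers *)

Lemma scaled_sinh_le (R : realType) (a r : R) : 0 < a < 1 -> 0 <= r ->
  expR (a * r) - expR (- (a * r)) <= a * (expR r - expR (- r)).
Proof.
move=> /andP[a0 a1] r0.
pose F (x : R) := a * (expR x - expR (- x)) - (expR (a * x) - expR (- (a * x))).
have dF (x : R) : is_derive x 1 F
    (a * (expR x + expR (- x)) - a * (expR (a * x) + expR (- (a * x)))).
  rewrite /F; apply: is_derive_eq.
  rewrite /GRing.scale /=; ring.
suff : F 0 <= F r.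
  rewrite /F !mulr0 oppr0 expR0 !subrr mulr0 subr0; lra.
apply: (@ger0_derive1_ndecry _ F 0); rewrite ?lexx //.
- move=> x; rewrite in_itv /= andbT => x0.
  rewrite derive1E (@derive_val _ _ _ _ _ _ _ (dF x)) -mulrBr.
  rewrite mulr_ge0 // ?(ltW a0) //.
  (* This difference is the derivative of [F] up to the factor [a]; factored, its sign is visible
     from [a * x <= x] and [0 <= x + a * x]. *)
  have -> : expR x + expR (- x) - (expR (a * x) + expR (- (a * x))) =
      (expR x - expR (a * x)) * (1 - expR (- (x + a * x))).
    rewrite mulrBr mulr1 mulrBl -!expRD.
    have -> : x - (x + a * x) = - (a * x) by ring.
    have -> : a * x - (x + a * x) = - x by ring.
    ring.
  apply: mulr_ge0; rewrite subr_ge0.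
    by rewrite ler_expR; nra.
  by rewrite -expR0 ler_expR oppr_le0; nra.
- apply: continuous_subspaceT => x; apply: differentiable_continuous.
  by apply/derivable1_diffP; have [] := dF x.
Qed.

(** With [s = exp (c - r)] and [t = exp (c + r)] both sides contain the factor [exp (2 (a + 1) c)];
    what remains is the square of [scaled_sinh_le]. *)
Lemma eikonal_powR (R : realType) (a s t : R) : 0 < a < 1 -> 0 < s -> 0 < t ->
  (s `^ a - t `^ a) ^+ 2 * (s * t) <=
  a ^+ 2 * (s `^ a * t `^ a * (s - t) ^+ 2).
Proof.
move=> a01; wlog st : s t / s <= t.
  move=> H s0 t0; case: (leP s t) => [|/ltW] st; first exact: H.
  by rewrite -(sqrrN (_ `^ _ - _)) opprB (mulrC s) (mulrC (s `^ a))
    -(sqrrN (s - t)) opprB H.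
move=> s0 t0; move: st; rewrite -(lnK s0) -(lnK t0) ler_expR.
rewrite /powR !gt_eqF ?expR_gt0 // !expRK.
move: (ln s) (ln t) => p q pq {s t s0 t0}.
pose c := (p + q) / 2; pose r := (q - p) / 2.
have -> : p = c - r by rewrite /c /r; field.
have -> : q = c + r by rewrite /c /r; field.
have r0 : 0 <= r by rewrite /r; lra.
have H := scaled_sinh_le a01 r0.
have H0 : 0 <= expR (a * r) - expR (- (a * r)).
  case/andP: a01 => a0 _.
  by rewrite subr_ge0 ler_expR; have := mulr_ge0 (ltW a0) r0; lra.
have {}H : (expR (a * r) - expR (- (a * r))) ^+ 2 <=
    (a * (expR r - expR (- r))) ^+ 2.
  by rewrite ler_pXn2r // ?nnegrE // (le_trans H0 H).
rewrite !mulrDr !mulrN !expRD.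
have e1 : expR (a * r) * expR (- (a * r)) = 1 by rewrite expRxMexpNx_1.
have e2 : expR r * expR (- r) = 1 by rewrite expRxMexpNx_1.
set A := expR (a * c); set B := expR c.
have AB0 : 0 <= (A * B) ^+ 2 by exact: sqr_ge0.
apply: le_trans (_ : (A * B) ^+ 2 *
   ((expR (a * r) - expR (- (a * r))) ^+ 2 * (expR r * expR (- r))) <= _).
  rewrite le_eqVlt; apply/orP; left; apply/eqP; ring.
rewrite e2 mulr1; apply: le_trans (ler_wpM2l AB0 H) _.
rewrite le_eqVlt; apply/orP; left; apply/eqP.
transitivity ((A * B) ^+ 2 * (a * (expR r - expR (- r))) ^+ 2
  * (expR (a * r) * expR (- (a * r)))); last by ring.
by rewrite e1 mulr1.
Qed.

(** * Green's formula and the Hardy inequality on a finite weighted graph *)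

Section FiniteSums.
Context {R : realType} {X : eqType}.
Implicit Types (b K : X -> X -> R) (S : seq X).
Implicit Types (g h k r u z chi psi phi : X -> R).

(** Each edge is counted in both orders, so the form of the subgraph on [S] is half of
    [edge_sum b S (dsq phi)]. *)
Definition edge_sum b S (F : X -> X -> R) : R :=
  \sum_(x <- S) \sum_(y <- S) b x y * F x y.

(** The Laplacian of the subgraph induced on [S], without the factor [1 / m], which cancels in
    pairings weighted by [m]. *)
Definition lap b S h (x : X) : R := \sum_(y <- S) b x y * (h x - h y).

Definition dsq h (x y : X) : R := (h x - h y) ^+ 2.

Variables (b : X -> X -> R) (S : seq X).
Hypothesis b_ge0 : forall x y, 0 <= b x y.
Hypothesis b_sym : forall x y, b x y = b y x.

Local Notation E := (edge_sum b S).
Local Notation L := (lap b S).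

Lemma edge_sum_le F G : (forall x y, F x y <= G x y) -> E F <= E G.
Proof.
by move=> FG; apply: ler_sum => x _; apply: ler_sum => y _; rewrite ler_wpM2l.
Qed.

Lemma edge_sumD F G : E (fun x y => F x y + G x y) = E F + E G.
Proof.
rewrite -big_split; apply: eq_bigr => x _; rewrite -big_split.
by apply: eq_bigr => y _; rewrite mulrDr.
Qed.

Lemma edge_sumZ c F : E (fun x y => c * F x y) = c * E F.
Proof.
rewrite mulr_sumr; apply: eq_bigr => x _; rewrite mulr_sumr.
by apply: eq_bigr => y _; rewrite mulrCA.
Qed.

Lemma edge_sum_tr F : E (fun x y => F y x) = E F.
Proof.
rewrite /edge_sum exchange_big; apply: eq_bigr => x _; apply: eq_bigr => y _.
by rewrite b_sym.
Qed.

Lemma edge_sum_ge0 F : (forall x y, 0 <= F x y) -> 0 <= E F.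
Proof.
by move=> F0; apply: sumr_ge0 => x _; apply: sumr_ge0 => y _; rewrite mulr_ge0.
Qed.

Lemma eq_edge_sum F G : (forall x y, F x y = G x y) -> E F = E G.
Proof.
by move=> FG; apply: eq_bigr => x _; apply: eq_bigr => y _; rewrite FG.
Qed.

(** There is no boundary term, since [lap] only sees [S]. Exchanging the names of [x] and [y] in one
    of two copies of the sum produces the terms with [k y]. *)
Lemma green h k :
  E (fun x y => (h x - h y) * (k x - k y)) = 2 * \sum_(x <- S) k x * L h x.
Proof.
have kL : \sum_(x <- S) k x * L h x = E (fun x y => k x * (h x - h y)).
  apply: eq_bigr => x _; rewrite mulr_sumr; apply: eq_bigr => y _.
  by rewrite mulrCA.
rewrite kL mulr_natl mulr2n -[X in _ = _ + X]edge_sum_tr -edge_sumD.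
by apply: eq_edge_sum => x y; ring.
Qed.

(** Picone's inequality: Green's formula pairs [g] with the test function [z ^ 2 / g], and on each
    edge the defect is a square divided by [g x * g y]. *)
Lemma hardy_edge_sum g z : (forall x, 0 < g x) ->
  2 * (\sum_(x <- S) z x ^+ 2 / g x * L g x) <= E (dsq z).
Proof.
move=> g0; rewrite -green; apply: edge_sum_le => x y.
rewrite /dsq -subr_ge0.
have -> : (z x - z y) ^+ 2 -
    (g x - g y) * (z x ^+ 2 / g x - z y ^+ 2 / g y) =
    (g x * z y - g y * z x) ^+ 2 / (g x * g y).
  by field; rewrite !gt_eqF.
by rewrite divr_ge0 ?sqr_ge0 // mulr_ge0 ?ltW.
Qed.

Lemma edge_sum_amgm K r : (forall x y, 0 <= K x y) ->
  (forall x y, K x y = K y x) ->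
  E (fun x y => `|r x * r y| * K x y) <= E (fun x y => r x ^+ 2 * K x y).
Proof.
move=> K0 Ks.
have -> : E (fun x y => r x ^+ 2 * K x y) =
    E (fun x y => 2^-1 * (r x ^+ 2 * K x y + r y ^+ 2 * K y x)).
  rewrite edge_sumZ edge_sumD (edge_sum_tr (fun x y => r x ^+ 2 * K x y)).
  by field.
apply: edge_sum_le => x y; rewrite (Ks y x) -mulrDl mulrA ler_wpM2r //.
rewrite normrM -(real_normK (num_real (r x))) -(real_normK (num_real (r y))).
have := sqr_ge0 (`|r x| - `|r y|); nra.
Qed.

(** On each edge, [2 p (p - q) = (p ^ 2 - q ^ 2) + (p - q) ^ 2]. Where [g ^ 2] is superharmonic,
    this bounds the gradient energy of [g] at [x] by [2 * (g x * L g x)]. *)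
Lemma mul_lap g x :
  2 * (g x * L g x) = L (fun y => g y ^+ 2) x + \sum_(y <- S) b x y * dsq g x y.
Proof.
rewrite mulrA mulr_sumr -big_split; apply: eq_bigr => y _ /=.
by rewrite /dsq; ring.
Qed.

Lemma lap_sqrt_ge0 g x : 0 < g x -> 0 <= L (fun y => g y ^+ 2) x -> 0 <= L g x.
Proof.
move=> g0 L0; rewrite -(pmulr_rge0 _ g0) -(@pmulr_rge0 _ 2) // mul_lap.
by rewrite addr_ge0 //; apply: sumr_ge0 => y _; rewrite mulr_ge0 // sqr_ge0.
Qed.

(** * Weighted energy estimates on a finite graph *)

Variables (al M : R) (g psi : X -> R).
Hypothesis g_gt0 : forall x, 0 < g x.
Hypothesis psi_ge0 : forall x, 0 <= psi x.
Hypothesis psi_le : forall x, psi x <= M.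
Hypothesis eikonal : forall x y,
  dsq psi x y * (g x * g y) <= al ^+ 2 * (psi x * psi y * dsq g x y).

(** For [rho = r * psi / g] the eikonal hypothesis moves the differences from [psi] to [g]. After
    [edge_sum_amgm], superharmonicity of [g ^ 2] on the support of [r] replaces them by [g * L g]
    through [mul_lap]. *)
Lemma eikonal_edge_sum r :
  (forall x, r x != 0 -> 0 <= L (fun y => g y ^+ 2) x) ->
  E (fun x y => `|r x * r y| * dsq psi x y) <=
  2 * al ^+ 2 * (\sum_(x <- S) (r x * psi x) ^+ 2 / g x * L g x).
Proof.
move=> Lg; pose rho x := r x * psi x / g x.
apply: (@le_trans _ _ (al ^+ 2 * E (fun x y => rho x ^+ 2 * dsq g x y))).
  have K0 x y : 0 <= dsq g x y by exact: sqr_ge0.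
  have Ks x y : dsq g x y = dsq g y x by rewrite /dsq; ring.
  apply: le_trans (ler_wpM2l (sqr_ge0 al) (edge_sum_amgm rho K0 Ks)).
  rewrite -edge_sumZ; apply: edge_sum_le => x y.
  have gg : 0 < g x * g y by rewrite mulr_gt0.
  have -> : rho x * rho y = r x * r y * (psi x * psi y / (g x * g y)).
    by rewrite /rho; field; rewrite !gt_eqF.
  rewrite [in leRHS]normrM (@ger0_norm _ (psi x * _ / _)); last first.
    by rewrite !(mulr_ge0, divr_ge0, invr_ge0) // ltW.
  rewrite (_ : al ^+ 2 * _ = `|r x * r y| *
      (al ^+ 2 * (psi x * psi y * dsq g x y) / (g x * g y))); last first.
    by field; rewrite !gt_eqF.
  by rewrite ler_wpM2l // ler_pdivlMr.
rewrite [leRHS](_ : _ = al ^+ 2 *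
  (2 * \sum_(x <- S) (r x * psi x) ^+ 2 / g x * L g x)); last by ring.
rewrite ler_wpM2l ?sqr_ge0 // mulr_sumr.
apply: ler_sum => x _.
under eq_bigr do rewrite mulrCA.
rewrite -mulr_sumr.
have -> : 2 * ((r x * psi x) ^+ 2 / g x * L g x) =
   rho x ^+ 2 * (2 * (g x * L g x)) by rewrite /rho; field; rewrite gt_eqF.
(* The sign of [L (g ^ 2)] is known on the support of [r] only; elsewhere both sides vanish. *)
rewrite mul_lap; have [r0|r0] := eqVneq (r x) 0.
  by rewrite /rho r0 !(mul0r, expr0n).
by rewrite ler_wpM2l ?sqr_ge0 // lerDr Lg.
Qed.

(** Green's formula with the test function [u * phi ^ 2]; the remainder contains differences of
    [phi] but none of [u]. *)
Lemma edge_sum_dsqM u phi :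
  E (dsq (fun x => u x * phi x)) =
  2 * (\sum_(x <- S) u x * phi x ^+ 2 * L u x) +
  E (fun x y => u x * u y * dsq phi x y).
Proof.
rewrite -green -edge_sumD; apply: eq_edge_sum => x y.
by rewrite /dsq; ring.
Qed.

(** The Hardy inequality for [u * psi * chi] is expanded by [edge_sum_dsqM]. In the remainder,
    differences of [psi] are absorbed by the left side through the eikonal estimate, and differences
    of [chi] form the cutoff error. *)
Lemma agmon_cutoff u chi : 0 < al < 1 -> (forall x, 0 <= chi x) ->
  (forall x, chi x != 0 -> 0 <= L (fun y => g y ^+ 2) x) ->
  (1 - al ^+ 2) ^+ 2 *
    (\sum_(x <- S) (u x * (psi x * chi x)) ^+ 2 / g x * L g x) <=
  (\sum_(x <- S) u x * (psi x * chi x) ^+ 2 * L u x) +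
  (4 + (1 - al ^+ 2)^-1) * M ^+ 2 * E (fun x y => u x ^+ 2 * dsq chi x y).
Proof.
move=> /andP[al0 al1] chi0 Lg; set e : R := 1 - al ^+ 2.
have e0 : 0 < e by rewrite /e; nra.
have e1 : e < 1 by rewrite /e; nra.
set phi := fun x => psi x * chi x; set W := \sum_(x <- S) _.
set T := \sum_(x <- S) u x * _ * _; set D := E _.
have H1 := hardy_edge_sum (fun x => u x * phi x) g_gt0.
rewrite edge_sum_dsqM in H1.
pose r x := u x * chi x.
have H2 : E (fun x y => u x * u y * dsq phi x y) <=
    (1 + e) * E (fun x y => `|r x * r y| * dsq psi x y) +
    (2 * (4 + e^-1) * M ^+ 2) * D.
  apply: (@le_trans _ _ (E (fun x y => (1 + e) * (`|r x * r y| * dsq psi x y) +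
       (2 * (4 + e^-1) * M ^+ 2) * (`|u x * u y| * dsq chi x y)))).
    apply: edge_sum_le => x y.
    apply: le_trans (_ : `|u x * u y| * dsq phi x y <= _).
      by rewrite ler_wpM2r ?sqr_ge0 // ler_norm.
    have -> : `|r x * r y| = `|u x * u y| * (chi x * chi y).
      rewrite -[X in _ = _ * X]ger0_norm ?mulr_ge0 // -normrM.
      by congr (`| _ |); rewrite /r; ring.
    rewrite [leRHS](_ : _ = `|u x * u y| *
      ((1 + e) * (chi x * chi y * dsq psi x y) +
       2 * (4 + e^-1) * M ^+ 2 * dsq chi x y)); last by ring.
    rewrite ler_wpM2l // /dsq /phi.
    have px := psi_le x; have py := psi_le y.
    have p0x := psi_ge0 x; have p0y := psi_ge0 y.
    set c := (chi x - chi y) ^+ 2.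
    have c0 : 0 <= c by exact: sqr_ge0.
    have ei : e * e^-1 = 1 by rewrite mulfV // gt_eqF.
    have ei0 : 0 < e^-1 by rewrite invr_gt0.
    (* The squared mean of [chi x] and [chi y] is [chi x * chi y] up to
       [dsq chi x y / 4], which is charged to the cutoff error. *)
    pose A := (chi x + chi y) / 2 * (psi x - psi y).
    pose B := (psi x + psi y) / 2 * (chi x - chi y).
    have -> : psi x * chi x - psi y * chi y = A + B by rewrite /A /B; field.
    (* The differences of [psi] sit in [A] and may gain only the factor [1 + e]: absorbing them
       needs [(1 + e) * al ^ 2 < 1]. The large factor goes to [B]. *)
    have AB : (A + B) ^+ 2 <= (1 + e) * A ^+ 2 + (1 + e^-1) * B ^+ 2.
      rewrite -subr_ge0.
      have -> : (1 + e) * A ^+ 2 + (1 + e^-1) * B ^+ 2 - (A + B) ^+ 2 =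
        e * (A - e^-1 * B) ^+ 2 + (1 - e * e^-1) * (e^-1 * B ^+ 2 - 2 * A * B).
        by ring.
      by rewrite ei subrr mul0r addr0 mulr_ge0 ?sqr_ge0 // ltW.
    apply: le_trans AB _.
    have A2 : A ^+ 2 <= chi x * chi y * (psi x - psi y) ^+ 2 + M ^+ 2 * c.
      have -> : A ^+ 2 = chi x * chi y * (psi x - psi y) ^+ 2 +
        c * (psi x - psi y) ^+ 2 / 4 by rewrite /A /c; field.
      rewrite lerD2l.
      have : (psi x - psi y) ^+ 2 <= M ^+ 2 by nra.
      by have := sqr_ge0 (psi x - psi y); nra.
    have B2 : B ^+ 2 <= M ^+ 2 * c.
      rewrite /B exprMn ler_wpM2r //.
      by rewrite ler_pXn2r ?nnegrE //; lra.
    have e1' : 0 <= 1 + e by lra.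
    have e2' : 0 <= 1 + e^-1 by lra.
    apply: le_trans (lerD (ler_wpM2l e1' A2) (ler_wpM2l e2' B2)) _.
    rewrite mulrDr -addrA lerD2l -mulrDl -[leRHS]mulrA.
    rewrite ler_wpM2r ?(mulr_ge0 (sqr_ge0 M) c0) //; lra.
  rewrite edge_sumD !edge_sumZ lerD2l ler_wpM2l //.
    by rewrite mulr_ge0 ?sqr_ge0 // mulr_ge0 // addr_ge0 // invr_ge0 ltW.
  by apply: edge_sum_amgm => x y; [exact: sqr_ge0|rewrite /dsq; ring].
have H3 : E (fun x y => `|r x * r y| * dsq psi x y) <= 2 * al ^+ 2 * W.
  have -> : W = \sum_(x <- S) (r x * psi x) ^+ 2 / g x * L g x.
    by apply: eq_bigr => x _; rewrite /r (mulrC (psi x)) mulrA.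
  apply: eikonal_edge_sum => x; rewrite mulf_eq0 negb_or => /andP[_].
  exact: Lg.
have e1' : 0 <= 1 + e by lra.
have {}H2 := le_trans H2 (lerD (ler_wpM2l e1' H3) (lexx _)).
have := le_trans H1 (lerD (lexx _) H2).
(* Absorption leaves the fraction [1 - (1 + e) * (1 - e) = e ^ 2] of [W]. *)
have -> : al ^+ 2 = 1 - e by rewrite /e; ring.
rewrite -/W -/T => H4.
rewrite -(ler_pM2l (_ : 0 < 2)) //; move: H4.
move: (e^-1) => ei; nra.
Qed.

(** Multiplication by [psi ^ 2] is bounded for the form: where the difference falls on [psi ^ 2],
    the eikonal estimate gives a Hardy sum for [phi], which the form of [phi] dominates. *)
Lemma edge_sum_dsq_sqrM phi : 0 < al < 1 ->
  (forall x, phi x != 0 -> 0 <= L (fun y => g y ^+ 2) x) ->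
  E (dsq (fun x => psi x ^+ 2 * phi x)) <= 12 * M ^+ 4 * E (dsq phi).
Proof.
move=> /andP[al0 al1] Lg.
have H1 : E (dsq (fun x => psi x ^+ 2 * phi x)) <= 4 * M ^+ 4 * E (dsq phi) +
    8 * M ^+ 2 * E (fun x y => `|phi x * phi y| * dsq psi x y).
  rewrite -!edge_sumZ -edge_sumD; apply: edge_sum_le => x y; rewrite /dsq.
  have px := psi_le x; have py := psi_le y.
  have p0x := psi_ge0 x; have p0y := psi_ge0 y.
  pose A := (psi x ^+ 2 + psi y ^+ 2) / 2; pose B := (phi x + phi y) / 2.
  pose d := psi x - psi y; pose s := psi x + psi y.
  have -> : psi x ^+ 2 * phi x - psi y ^+ 2 * phi y =
      A * (phi x - phi y) + B * (d * s) by rewrite /A /B /d /s; field.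
  have H (p q : R) : (p + q) ^+ 2 <= 2 * p ^+ 2 + 2 * q ^+ 2.
    by have := sqr_ge0 (p - q); nra.
  apply: le_trans (H _ _) _.
  set c := (phi x - phi y) ^+ 2.
  have c0 : 0 <= c by exact: sqr_ge0.
  have A2 : A ^+ 2 <= M ^+ 4.
    rewrite (_ : M ^+ 4 = (M ^+ 2) ^+ 2); last by rewrite -exprM.
    have ? : psi x ^+ 2 <= M ^+ 2 by nra.
    have ? : psi y ^+ 2 <= M ^+ 2 by nra.
    rewrite /A ler_pXn2r ?nnegrE ?divr_ge0 ?addr_ge0 ?sqr_ge0 //; lra.
  have d2 : d ^+ 2 <= M ^+ 2 by rewrite /d; nra.
  have s2 : s ^+ 2 <= 4 * M ^+ 2 by rewrite /s; nra.
  have B2 : B ^+ 2 <= `|phi x * phi y| + c / 4.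
    have -> : B ^+ 2 = phi x * phi y + c / 4 by rewrite /B /c; field.
    by rewrite lerD2r ler_norm.
  (* Two bounds of one product: the crude one serves the part [c / 4] of [B ^ 2]; the one that keeps
     [d ^ 2] serves the part [|phi x * phi y|]. *)
  have ds : d ^+ 2 * s ^+ 2 <= 4 * M ^+ 4.
    rewrite (_ : M ^+ 4 = M ^+ 2 * M ^+ 2); last by rewrite -exprD.
    by rewrite [leRHS]mulrCA ler_pM ?sqr_ge0.
  have ds' : d ^+ 2 * s ^+ 2 <= 4 * M ^+ 2 * d ^+ 2.
    by rewrite mulrC ler_wpM2r ?sqr_ge0.
  have ds0 : 0 <= d ^+ 2 * s ^+ 2 by rewrite mulr_ge0 ?sqr_ge0.
  rewrite (exprMn 2 A) (exprMn 2 B) (exprMn 2 d) -/c.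
  have := ler_wpM2r c0 A2.
  have := ler_wpM2r ds0 B2.
  have := ler_wpM2l (normr_ge0 (phi x * phi y)) ds'.
  have := ler_wpM2l c0 ds.
  move: (`|phi x * phi y| : R) (d ^+ 2 * s ^+ 2) => N Z.
  by rewrite -/d => *; lra.
apply: le_trans H1 _.
have W0 x : phi x != 0 -> 0 <= L g x.
  by move=> p0; apply: lap_sqrt_ge0 => //; exact: Lg.
have H2 := eikonal_edge_sum Lg.
have H3 := hardy_edge_sum phi g_gt0.
have H4 : \sum_(x <- S) (phi x * psi x) ^+ 2 / g x * L g x <=
    M ^+ 2 * \sum_(x <- S) (phi x) ^+ 2 / g x * L g x.
  rewrite mulr_sumr; apply: ler_sum => x _.
  have [->|p0] := eqVneq (phi x) 0; first by rewrite !(mul0r, expr0n, mulr0).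
  rewrite exprMn [leLHS](_ : _ = psi x ^+ 2 * (phi x ^+ 2 / g x * L g x)).
    have W0' := mulr_ge0 (divr_ge0 (sqr_ge0 (phi x)) (ltW (g_gt0 x))) (W0 x p0).
    rewrite ler_wpM2r //.
    by have := psi_ge0 x; have := psi_le x; nra.
  by field; rewrite gt_eqF.
have H5 : 0 <= \sum_(x <- S) (phi x) ^+ 2 / g x * L g x.
  apply: sumr_ge0 => x _.
  have [->|p0] := eqVneq (phi x) 0; first by rewrite !(mul0r, expr0n, mulr0).
  by rewrite mulr_ge0 ?W0 // divr_ge0 ?sqr_ge0 // ltW.
have M2 := sqr_ge0 M.
have H6 : E (fun x y => `|phi x * phi y| * dsq psi x y) <=
    M ^+ 2 * E (dsq phi).
  apply: le_trans H2 _.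
  have a2 : 0 <= 2 * al ^+ 2 by rewrite mulr_ge0 ?sqr_ge0.
  apply: le_trans (ler_wpM2l a2 H4) _.
  apply: le_trans (ler_wpM2l M2 H3); rewrite mulrCA ler_wpM2l //.
  by rewrite ler_wpM2r //; nra.
have M8 : 0 <= 8 * M ^+ 2 by rewrite mulr_ge0.
have := ler_wpM2l M8 H6.
have -> : 8 * M ^+ 2 * (M ^+ 2 * E (dsq phi)) = 8 * M ^+ 4 * E (dsq phi).
  by ring.
by move=> *; lra.
Qed.

(** Here [phi] stands for an approximation of [u], and [psi ^ 2 * phi] is the test function.
    Replacing differences of [phi] by those of [u] costs two Young terms with parameter [d];
    [edge_sum_dsq_sqrM] controls the second. *)
Lemma agmon_form u phi (d : R) : 0 < al < 1 -> 0 < d ->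
  (forall x, phi x != 0 -> 0 <= L (fun y => g y ^+ 2) x) ->
  (1 - al ^+ 2) *
    (\sum_(x <- S) (phi x * psi x) ^+ 2 / g x * L g x) <=
  (\sum_(x <- S) psi x ^+ 2 * phi x * L u x) +
  d^-1 * E (dsq (fun x => phi x - u x)) + d * (12 * M ^+ 4 * E (dsq phi)).
Proof.
move=> al01 d0 Lg.
have H1 := hardy_edge_sum (fun x => phi x * psi x) g_gt0.
have H2 := eikonal_edge_sum Lg.
have H3 := edge_sum_dsq_sqrM al01 Lg.
set W := \sum_(x <- S) _ in H1 H2 *.
pose k x := psi x ^+ 2 * phi x.
have H4 : E (dsq (fun x => phi x * psi x)) <=
   E (fun x y => (u x - u y) * (k x - k y)) +
   (2 * d^-1 * E (dsq (fun x => phi x - u x)) + 2 * d * E (dsq k)) +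
   E (fun x y => `|phi x * phi y| * dsq psi x y).
  rewrite -!edge_sumZ -!edge_sumD; apply: edge_sum_le => x y; rewrite /dsq.
  have -> : (phi x * psi x - phi y * psi y) ^+ 2 =
     (u x - u y) * (k x - k y) +
     (phi x - u x - (phi y - u y)) * (k x - k y) +
     phi x * phi y * (psi x - psi y) ^+ 2 by rewrite /k; ring.
  apply: lerD; last by rewrite ler_wpM2r ?sqr_ge0 // ler_norm.
  rewrite lerD2l; move: (phi x - u x - _) (k x - k y) => p q.
  have dd : d * d^-1 = 1 by rewrite mulfV // gt_eqF.
  have di : 0 < d^-1 by rewrite invr_gt0.
  have Hp := sqr_ge0 p; have Hq := sqr_ge0 q.
  (* Young's inequality for [p * q] by completing squares; the terms with the factor [1 - d * d^-1]
     are zero. *)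
  have -> : 2 * d^-1 * p ^+ 2 + 2 * d * q ^+ 2 =
    d^-1 * p ^+ 2 + d * q ^+ 2 + d * (q - d^-1 * p) ^+ 2 +
    2 * (d * d^-1) * (p * q) + (1 - d * d^-1) * (d^-1 * p ^+ 2) by ring.
  rewrite dd subrr mul0r addr0 mulr1.
  have h1 : 0 <= d * (q - d^-1 * p) ^+ 2 by rewrite mulr_ge0 ?sqr_ge0 ?ltW.
  have h2 : d^-1 * p ^+ 2 + d * q ^+ 2 + 2 * (p * q) =
     d * (q + d^-1 * p) ^+ 2 + (1 - d * d^-1) * (d^-1 * p ^+ 2 + 2 * (p * q)).
    by ring.
  have h3 : 0 <= d * (q + d^-1 * p) ^+ 2 by rewrite mulr_ge0 ?sqr_ge0 ?ltW.
  rewrite dd subrr mul0r addr0 in h2.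
  have h4 : 0 <= d^-1 * p ^+ 2 by rewrite mulr_ge0 // ltW.
  have h5 : 0 <= d * q ^+ 2 by rewrite mulr_ge0 // ltW.
  lra.
rewrite (green u k) in H4.
have H5 := ler_wpM2l (ltW d0) H3.
have H6 := le_trans H1 (le_trans H4 (lerD (lexx _) H2)).
change (\sum_(x <- S) psi x ^+ 2 * phi x * L u x)
  with (\sum_(x <- S) k x * L u x).
move: H5 H6; rewrite -/k -/W.
move: (d^-1) (\sum_(x <- S) k x * L u x) (E (dsq k)) (E (dsq phi)) (E _).
move: (al ^+ 2) (M ^+ 4).
move=> *; lra.
Qed.

End FiniteSums.

(** * Limits of finite sums, and unordered sums against finite ones *)

Lemma cvg_sum_seq (R : realType) (I : eqType) (s : seq I) (F : nat -> I -> R)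
    (l : I -> R) :
  (forall i, F n i @[n --> \oo] --> l i) ->
  \sum_(i <- s) F n i @[n --> \oo] --> \sum_(i <- s) l i.
Proof.
move=> Fl; elim: s => [|i s IHs].
  by rewrite big_nil; under eq_fun do rewrite big_nil; exact: cvg_cst.
by rewrite big_cons; under eq_fun do rewrite big_cons; exact: cvgD.
Qed.

Lemma cvge0_near_le (R : realType) (f : nat -> \bar R) (e : R) :
  f n @[n --> \oo] --> 0%E -> 0 < e -> \forall n \near \oo, (f n <= e%:E)%E.
Proof.
move=> f0 e0; apply: (f0 [set y | (y <= e%:E)%E]).
have := @nbhs_open_ereal_lt _ 0 (fun=> e) e0.
by apply: filterS => y /= /ltW.
Qed.

Lemma eq_sum_support (R : realType) (I : eqType) (s t : seq I) (F : I -> R) :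
  uniq s -> uniq t -> (forall x, F x != 0 -> x \in s) ->
  (forall x, F x != 0 -> x \in t) -> \sum_(x <- s) F x = \sum_(x <- t) F x.
Proof.
have supp r : \sum_(x <- r) F x = \sum_(x <- [seq x <- r | F x != 0]) F x.
  rewrite big_filter [RHS]big_mkcond; apply: eq_bigr => x _.
  by case: eqVneq.
move=> us ut Fs Ft; rewrite supp [RHS]supp; apply: perm_big.
apply: uniq_perm; rewrite ?filter_uniq // => x; rewrite !mem_filter.
by case: eqVneq => // /[dup] /Fs -> /Ft ->.
Qed.

Lemma ler_sum_subseq (R : realType) (I : eqType) (s t : seq I) (F : I -> R) :
  uniq s -> uniq t -> (forall x, x \in t -> 0 <= F x) ->
  (forall x, x \in s -> F x != 0 -> x \in t) ->
  \sum_(x <- s) F x <= \sum_(x <- t) F x.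
Proof.
move=> us ut F0 st.
have -> : \sum_(x <- s) F x = \sum_(x <- [seq x <- s | x \in t]) F x.
  rewrite big_filter [RHS]big_mkcond; apply: eq_big_seq => x xs.
  have [//|xt] := boolP (x \in t).
  by apply/eqP; apply: contraNT xt; exact: st.
rewrite (perm_big [seq x <- t | x \in s]) /=; last first.
  by apply: uniq_perm; rewrite ?filter_uniq // => x; rewrite !mem_filter andbC.
rewrite big_filter [leLHS]big_mkcond big_seq [leRHS]big_seq.
by apply: ler_sum => x xt; case: ifP => // _; exact: F0.
Qed.

Section EsumSeq.
Context {R : realType} {X : choiceType}.
Implicit Types (s : seq X).

Lemma le_esum_seq s (F : X -> \bar R) : uniq s ->
  (\sum_(x <- s) F x <= \esum_(x in [set: X]) F x)%E.
Proof.
move=> us; apply: esum_ge; exists [set` s]; last by rewrite fsbig_seq.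
by split => //; exact: finite_seq.
Qed.

Lemma esum_le_seq (F : X -> \bar R) (C : \bar R) :
  (forall s, uniq s -> (\sum_(x <- s) F x <= C)%E) ->
  (\esum_(x in [set: X]) F x <= C)%E.
Proof.
move=> H; apply: ge_ereal_sup => _ [A [finA _] <-].
by rewrite fsbig_finite //= H.
Qed.

End EsumSeq.

(** Both parts of [F] are supported in [s], so their unordered sums are finite and [fine] returns
    their true values. *)
Lemma sumX_seq (R : realType) (X : countType) (s : seq X) (F : X -> R) :
  uniq s -> (forall x, F x != 0 -> x \in s) -> sumX F = \sum_(x <- s) F x.
Proof.
move=> us Fs.
have E (G : X -> R) : (forall x, 0 <= G x) -> (forall x, G x != 0 -> x \in s) ->
    (\esum_(x in [set: X]) (G x)%:E)%E = (\sum_(x <- s) G x)%:E.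
  move=> G0 Gs; apply/eqP; rewrite eq_le; apply/andP; split.
    apply: esum_le_seq => t ut; rewrite sumEFin lee_fin.
    by apply: ler_sum_subseq => // x _; exact: Gs.
  by rewrite -sumEFin; exact: le_esum_seq.
have s_pos x : F^\+ x != 0 -> x \in s.
  by apply: contraNT => /(contraNN (Fs x)); rewrite negbK /funrpos => /eqP ->;
    rewrite maxxx.
have s_neg x : F^\- x != 0 -> x \in s.
  by apply: contraNT => /(contraNN (Fs x)); rewrite negbK /funrneg => /eqP ->;
    rewrite oppr0 maxxx.
rewrite /sumX (E _ (funrpos_ge0 F) s_pos) (E _ (funrneg_ge0 F) s_neg).
rewrite /= -sumrB; apply: eq_bigr => x _.
by have /(congr1 (@^~ x)) := funrposBneg F.
Qed.

(** * Finite portions of the locally finite graph *)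

Section Linking.
Context {R : realType} {X : countType}.
Variables (m : X -> R) (b : X -> X -> R).
Hypothesis m_gt0 : forall x, 0 < m x.
Hypothesis b_graph : is_graph b.
Hypothesis b_lf : locally_finite b.
Implicit Types (s t : seq X) (h u phi chi : X -> R).

Definition nbr (x : X) : seq X := fset_set [set y | graph_adj b x y].

Lemma mem_nbr x y : (y \in nbr x) = (b x y != 0).
Proof.
rewrite in_fset_set; last exact: b_lf.
have b0 : 0 <= b x y by exact: graph_ge0.
have adjE : graph_adj b x y = (b x y != 0) by rewrite /graph_adj lt0r b0 andbT.
by apply/idP/idP => [/set_mem|?]; [|apply: mem_set]; rewrite /= adjE.
Qed.

(* [s] together with all its neighbours, so that [lap b (hull s)] is exact on
   [s]. *)
Definition hull s : seq X := undup (s ++ flatten [seq nbr x | x <- s]).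

Lemma hull_uniq s : uniq (hull s). Proof. exact: undup_uniq. Qed.

Lemma sub_hull s x : x \in s -> x \in hull s.
Proof. by move=> xs; rewrite mem_undup mem_cat xs. Qed.

Lemma nbr_hull s x y : x \in s -> y \in nbr x -> y \in hull s.
Proof.
move=> xs xy; rewrite mem_undup mem_cat; apply/orP; right.
by apply/flattenP; exists (nbr x) => //; exact: map_f.
Qed.

(** The formal operator without [1 / m], for direct comparison with [lap]. *)
Definition mop h (x : X) : R := lap b (nbr x) h x.

Lemma lap_hull s h x : x \in s -> lap b (hull s) h x = mop h x.
Proof.
move=> xs; apply: eq_sum_support; rewrite ?hull_uniq ?fset_uniq //.
  move=> y; rewrite mulf_eq0 negb_or => /andP[bxy _].
  by apply: (nbr_hull xs); rewrite mem_nbr.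
by move=> y; rewrite mulf_eq0 negb_or => /andP[bxy _]; rewrite mem_nbr.
Qed.

Lemma mop_formal_op h x : mop h x = m x * formal_op m b h x.
Proof.
rewrite /formal_op mulVKf ?gt_eqF // (@sumX_seq _ _ (nbr x)) //.
  exact: fset_uniq.
by move=> y; rewrite mulf_eq0 negb_or => /andP[bxy _]; rewrite mem_nbr.
Qed.

(** The factor [2^-1] is the one in [gradsq], whose mass cancels against [m x]; restricting both
    sums to [s] drops nonnegative terms. *)
Lemma edge_sum_gradsq s c chi : uniq s ->
  ((2^-1 * edge_sum b s (fun x y => c x ^+ 2 * dsq chi x y))%:E <=
   \esum_(x in [set: X]) ((c x ^+ 2)%:E * gradsq m b chi x * (m x)%:E))%E.
Proof.
move=> us; apply: le_trans (le_esum_seq _ us).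
rewrite /edge_sum mulr_sumr -sumEFin; apply: lee_sum => x _.
have -> : 2^-1 * (\sum_(y <- s) b x y * (c x ^+ 2 * dsq chi x y)) =
    c x ^+ 2 * ((2 * m x)^-1 * (\sum_(y <- s) b x y * dsq chi x y)) * m x.
  under eq_bigr do rewrite mulrCA.
  by rewrite -mulr_sumr; field; rewrite gt_eqF.
rewrite (EFinM (_ * _) (m x)) (EFinM (c x ^+ 2)) (EFinM (2 * m x)^-1).
have mx := ltW (m_gt0 x).
rewrite lee_wpmul2r ?lee_fin // lee_wpmul2l ?lee_fin ?sqr_ge0 //.
rewrite /gradsq lee_wpmul2l ?lee_fin ?invr_ge0 ?mulr_ge0 //.
by rewrite -sumEFin; exact: le_esum_seq.
Qed.

Lemma edge_sum_graph_form s chi : uniq s ->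
  ((2^-1 * edge_sum b s (dsq chi))%:E <= graph_form m b chi)%E.
Proof.
move=> us; have := @edge_sum_gradsq s (fun=> 1) chi us.
have -> : edge_sum b s (fun x y => 1 ^+ 2 * dsq chi x y) =
    edge_sum b s (dsq chi).
  by apply: eq_edge_sum => x y; rewrite expr1n mul1r.
move=> /le_trans; apply; rewrite le_eqVlt; apply/orP; left; apply/eqP.
by apply: eq_esum => x _; rewrite expr1n mul1e.
Qed.

(** By local finiteness, every edge on which [phi] varies has both ends in the finite hull of its
    support, so the sum over that hull bounds all others. *)
Lemma edge_sum_dsq_bounded phi : finitely_supported phi ->
  exists B : R, forall s, uniq s -> edge_sum b s (dsq phi) <= B.
Proof.
move=> /finite_seqP[s0 Es0].
have Hs x : phi x != 0 -> x \in s0.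
  by move=> p0; suff : [set` s0] x by []; rewrite -Es0.
have b0 := graph_ge0 b_graph; have bs := graph_sym b_graph.
pose T := hull s0.
have T1 x y : b x y * dsq phi x y != 0 -> y \in T.
  rewrite mulf_eq0 negb_or => /andP[bxy]; rewrite /dsq sqrf_eq0 => d0.
  have [py|/Hs/sub_hull //] := eqVneq (phi y) 0.
  have /Hs xs : phi x != 0 by move: d0; rewrite py subr0.
  by apply: (nbr_hull xs); rewrite mem_nbr.
exists (edge_sum b T (dsq phi)) => s us.
apply: (@le_trans _ _ (\sum_(x <- s) \sum_(y <- T) b x y * dsq phi x y)).
  apply: ler_sum => x _; apply: ler_sum_subseq; rewrite ?hull_uniq //.
    by move=> y _; rewrite mulr_ge0 ?b0 ?sqr_ge0.
  by move=> y _; exact: T1.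
apply: ler_sum_subseq; rewrite ?hull_uniq //.
  by move=> x _; apply: sumr_ge0 => y _; rewrite mulr_ge0 ?b0 ?sqr_ge0.
move=> x _; apply: contraNT => xT; rewrite big1 // => y _.
apply: contraNeq xT; rewrite bs => H; apply: (T1 y x).
by rewrite /dsq -sqrrN opprB.
Qed.

(** * Weighted bounds on the whole graph, uniform in the finite test set *)

Section Weighted.
Variables (f u g psi : X -> R) (al M : R) (Sf : seq X).
Hypothesis al01 : 0 < al < 1.
Hypothesis Sf_uniq : uniq Sf.
Hypothesis Sf_supp : forall x, f x != 0 -> x \in Sf.
Hypothesis g_gt0 : forall x, 0 < g x.
Hypothesis g_super : forall x, 0 <= mop (fun y => g y ^+ 2) x.
Hypothesis psi_ge0 : forall x, 0 <= psi x.
Hypothesis psi_le : forall x, psi x <= M.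
Hypothesis eikonal : forall x y,
  dsq psi x y * (g x * g y) <= al ^+ 2 * (psi x * psi y * dsq g x y).

Let b0 := graph_ge0 b_graph.
Let bs := graph_sym b_graph.

(** Bounds the source term [sum f u psi ^ 2 m], also after inserting a cutoff with values in
    [[0, 1]]. *)
Let C0 := \sum_(x <- Sf) `|u x| * psi x ^+ 2 * (`|f x| * m x).

Lemma mop_sqrt_ge0 x : 0 <= mop g x.
Proof. by apply: lap_sqrt_ge0 => //; exact: g_super. Qed.

(** Since [mop g] is nonnegative, enlarging the sum to the support of [z], which lies in [S], can
    only increase it. *)
Lemma weight_seq_le (F S : seq X) (z : X -> R) : uniq F -> uniq S ->
  (forall x, z x != 0 -> x \in S /\ lap b S g x = mop g x) ->
  \sum_(x <- F) z x ^+ 2 / g x * mop g x <=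
  \sum_(x <- S) z x ^+ 2 / g x * lap b S g x.
Proof.
move=> uF uS zS.
have -> : \sum_(x <- S) z x ^+ 2 / g x * lap b S g x =
    \sum_(x <- S) z x ^+ 2 / g x * mop g x.
  apply: eq_bigr => x _.
  by have [->|/zS[_ ->//]] := eqVneq (z x) 0; rewrite !(expr0n, mul0r).
apply: ler_sum_subseq => // x _.
  by rewrite mulr_ge0 ?mop_sqrt_ge0 // divr_ge0 ?sqr_ge0 // ltW.
have [->|/zS[] //] := eqVneq (z x) 0.
by rewrite !(expr0n, mul0r) eqxx.
Qed.

(** [agmon_cutoff] is applied on the hull of the support of [chi n], where [lap] is exact on that
    support. [F] stays fixed while [n] grows, and approximability makes the cutoff error at most
    1. *)
Lemma agmon_approximable (F : seq X) : uniq F -> approximable m b u ->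
  (solution m b f u \/ (forall x, 0 <= u x) /\ subsolution m b f u) ->
  (1 - al ^+ 2) ^+ 2 *
    (\sum_(x <- F) (u x * psi x) ^+ 2 / g x * mop g x) <= C0 + 1.
Proof.
move=> uF [_ [chi [chi_fin chi0 chi_nd chi1 chi_grad]]] u_sol.
have chi_le1 n x : chi n x <= 1.
  have <- := cvg_lim (@Rhausdorff R) (chi1 x).
  by apply: nondecreasing_cvgn_le; [exact: chi_nd|apply/cvg_ex; exists 1].
(* The cutoff error is at most [K * (D / 2)], so energy at most [K^-1] suffices; the summand 1 makes
   [K] positive. *)
pose K := 2 * (4 + (1 - al ^+ 2)^-1) * M ^+ 2 + 1.
have e0 : 0 < 1 - al ^+ 2 by case/andP: al01 => *; nra.
have K0 : 0 < K.
  rewrite ltr_pwDr // mulr_ge0 ?sqr_ge0 // mulr_ge0 // addr_ge0 //.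
  by rewrite invr_ge0 ltW.
pose A n := (1 - al ^+ 2) ^+ 2 *
    (\sum_(x <- F) (u x * (psi x * chi n x)) ^+ 2 / g x * mop g x).
have A_lim : A n @[n --> \oo] --> (1 - al ^+ 2) ^+ 2 *
    (\sum_(x <- F) (u x * psi x) ^+ 2 / g x * mop g x).
  apply: cvgMr; apply: cvg_sum_seq => x.
  rewrite -[in X in _ --> X](mulr1 (psi x)).
  apply: cvgMl; apply: cvgMl; under eq_fun do rewrite expr2.
  rewrite expr2; apply: cvgM; apply: cvgMr; apply: cvgMr; exact: chi1.
apply: (cvgr_to_le A_lim).
have := cvge0_near_le chi_grad (_ : 0 < K^-1); rewrite invr_gt0 K0.
move=> /(_ isT); apply: filterS => n chi_n.
have [s Es] : exists s, [set x | chi n x != 0] = [set` s].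
  by apply/finite_seqP; exact: chi_fin.
have Hs x : chi n x != 0 -> x \in s.
  by move=> p0; suff : [set` s] x by []; rewrite -Es.
pose S := hull s.
have uS : uniq S by exact: hull_uniq.
have Lg x : chi n x != 0 -> 0 <= lap b S (fun y => g y ^+ 2) x.
  by move=> /Hs xs; rewrite lap_hull.
have := agmon_cutoff b0 bs g_gt0 psi_ge0 psi_le eikonal u al01 (chi0 n) Lg.
set T := \sum_(x <- S) u x * (psi x * chi n x) ^+ 2 * _.
set D := edge_sum _ _ _ => H.
have D1 : 2^-1 * D <= K^-1.
  by rewrite -lee_fin (le_trans _ chi_n) // edge_sum_gradsq.
have T1 : T <= C0.
  apply: (@le_trans _ _
      (\sum_(x <- S) u x * (psi x * chi n x) ^+ 2 * (m x * f x))).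
    apply: ler_sum => x _.
    have [->|c0] := eqVneq (chi n x) 0.
      by rewrite !(mulr0, expr0n, mul0r).
    rewrite lap_hull ?Hs // mop_formal_op.
    (* A solution gives equality here; for a subsolution the inequality is multiplied by a factor
       that is nonnegative because [u] is. *)
    case: u_sol => [[_ ->//]|[u0 [_ uf]]].
    rewrite ler_wpM2l //; last by rewrite ler_wpM2l // ltW.
    by have := mulr_ge0 (u0 x) (sqr_ge0 (psi x * chi n x)).
  apply: (@le_trans _ _ (\sum_(x <- S)
      `|u x| * psi x ^+ 2 * (`|f x| * m x) * (x \in Sf)%:R)).
    apply: ler_sum => x _.
    have [fx|/Sf_supp ->] := eqVneq (f x) 0.
      by rewrite fx normr0 !(mul0r, mulr0).
    rewrite mulr1.
    apply: le_trans (ler_norm _) _.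
    rewrite (normrM (_ * _)) (normrM (u x)) (normrM (m x)) (gtr0_norm (m_gt0 x)).
    rewrite (ger0_norm (sqr_ge0 _)) (mulrC (m x)).
    apply: ler_wpM2r; first by rewrite mulr_ge0 // ltW.
    apply: ler_wpM2l => //; rewrite exprMn ler_piMr ?sqr_ge0 //.
    by rewrite expr_le1 // chi0.
  rewrite (eq_bigr (fun x =>
      if x \in Sf then `|u x| * psi x ^+ 2 * (`|f x| * m x) else 0)).
    rewrite -big_mkcond -big_filter.
    apply: ler_sum_subseq; rewrite ?filter_uniq //.
      by move=> x _; rewrite !mulr_ge0 ?sqr_ge0 // ltW.
    by move=> x; rewrite mem_filter => /andP[].
  by move=> x _; case: ifP; rewrite (mulr1, mulr0).
have AH : A n <= (1 - al ^+ 2) ^+ 2 *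
    (\sum_(x <- S) (u x * (psi x * chi n x)) ^+ 2 / g x * lap b S g x).
  apply: ler_wpM2l; first exact: sqr_ge0.
  apply: (@weight_seq_le F S (fun x => u x * (psi x * chi n x))) => // x.
  rewrite !mulf_eq0 !negb_or => /and3P[_ _ /Hs xs].
  by split; [exact: sub_hull|exact: lap_hull].
apply: le_trans AH (le_trans H _); apply: lerD => //.
have KD : K * (2^-1 * D) <= 1.
  by have := ler_wpM2l (ltW K0) D1; rewrite mulfV // gt_eqF.
apply: le_trans KD; rewrite /K.
have D0 : 0 <= D.
  by apply: edge_sum_ge0 => // x y; rewrite mulr_ge0 ?sqr_ge0.
lra.
Qed.

(** [agmon_form] is applied to the form approximants [phi n]. Their energies are eventually bounded,
    so [d] can be fixed first, and then both error terms are at most 1 for large [n]. *)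
Lemma agmon_closure (F : seq X) : uniq F -> closure_dom m b u ->
  solution m b f u ->
  (1 - al ^+ 2) * (\sum_(x <- F) (u x * psi x) ^+ 2 / g x * mop g x) <= C0 + 2.
Proof.
move=> uF [_ [phi [phi_fin phi_u phi_cauchy]]] [_ u_sol].
(* A single term of the [ell^2] distance already controls the value at [x], as [m x > 0]. *)
have phi_cvg x : phi n x @[n --> \oo] --> u x.
  apply/cvgrPdist_le => e e_gt0.
  have := cvge0_near_le phi_u (mulr_gt0 (exprn_gt0 2 e_gt0) (m_gt0 x)).
  apply: filterS => n /(le_trans (le_esum_seq _ (isT : uniq [:: x]))).
  rewrite big_seq1 lee_fin ler_pM2r // -normrN opprB => H.
  by rewrite -[leRHS]gtr0_norm // -ler_sqr ?nnegrE // !real_normK ?num_real.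
have [N0 HN0] := phi_cauchy 1 ltr01.
have [B0 HB0] := edge_sum_dsq_bounded (phi_fin N0).
have B00 : 0 <= B0.
  by have := HB0 [::] isT; rewrite /edge_sum big_nil.
(* From [(p + q) ^ 2 <= 2 p ^ 2 + 2 q ^ 2]: the difference from [phi N0] has edge sum at most 2, and
   [phi N0] at most [B0]. *)
pose B := 4 + 2 * B0.
have HB n S : (N0 <= n)%N -> uniq S -> edge_sum b S (dsq (phi n)) <= B.
  move=> Nn uS.
  have H1 : 2^-1 * edge_sum b S (dsq (phi n \- phi N0)) <= 1.
    rewrite -lee_fin; apply: le_trans (edge_sum_graph_form _ uS) _.
    exact: HN0.
  have H2 : edge_sum b S (dsq (phi n)) <=
      2 * edge_sum b S (dsq (phi n \- phi N0)) +
      2 * edge_sum b S (dsq (phi N0)).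
    rewrite -!edge_sumZ -edge_sumD; apply: edge_sum_le => // x y.
    rewrite /dsq /=.
    move: (phi n x) (phi n y) (phi N0 x) (phi N0 y) => p q r t.
    have := sqr_ge0 ((p - q) - 2 * (r - t)); nra.
  have := HB0 S uS; rewrite /B; lra.
have M4 : 0 <= 12 * M ^+ 4.
  by rewrite mulr_ge0 // (_ : M ^+ 4 = (M ^+ 2) ^+ 2) ?sqr_ge0 // -exprM.
have B_ge0 : 0 <= B by rewrite /B; lra.
(* Makes the second error term at most 1; the first is then handled by taking [n] so large that the
   edge sum of [phi n - u] is at most [d]. *)
pose d := (12 * M ^+ 4 * B + 1)^-1.
have d0 : 0 < d by rewrite invr_gt0 ltr_pwDr // mulr_ge0.
have [N1 HN1] : exists N, forall n k, (N <= n)%N -> (N <= k)%N ->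
    (graph_form m b (phi n \- phi k)%R <= (2^-1 * d)%:E)%E.
  by apply: phi_cauchy; rewrite mulr_gt0 // invr_gt0.
have HD n S : (N1 <= n)%N -> uniq S ->
    edge_sum b S (dsq (fun x => phi n x - u x)) <= d.
  move=> Nn uS.
  (* Lower semicontinuity: on the finite set [S] the Cauchy bound passes to the pointwise limit in
     [k]. *)
  have lim : edge_sum b S (dsq (phi n \- phi k)) @[k --> \oo] -->
      edge_sum b S (dsq (fun x => phi n x - u x)).
    apply: cvg_sum_seq => x; apply: cvg_sum_seq => y; apply: cvgMr.
    rewrite /dsq expr2; under eq_fun do rewrite expr2.
    apply: cvgM; apply: cvgB; apply: cvgB; (exact: cvg_cst || exact: phi_cvg).
  apply: (cvgr_to_le lim); exists N1 => // k /= Nk.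
  rewrite -(@ler_pM2l _ 2^-1) // -lee_fin.
  by apply: le_trans (edge_sum_graph_form _ uS) _; exact: HN1.
pose A n := (1 - al ^+ 2) *
    (\sum_(x <- F) (phi n x * psi x) ^+ 2 / g x * mop g x).
pose T n := (\sum_(x <- Sf) psi x ^+ 2 * phi n x * (m x * f x)) + 2.
have A_lim : A n @[n --> \oo] --> (1 - al ^+ 2) *
    (\sum_(x <- F) (u x * psi x) ^+ 2 / g x * mop g x).
  apply: cvgMr; apply: cvg_sum_seq => x.
  apply: cvgMl; apply: cvgMl; under eq_fun do rewrite expr2.
  rewrite expr2; apply: cvgM; apply: cvgMl; exact: phi_cvg.
have T_lim : T n @[n --> \oo] -->
    (\sum_(x <- Sf) psi x ^+ 2 * u x * (m x * f x)) + 2.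
  apply: cvgD; last exact: cvg_cst.
  apply: cvg_sum_seq => x; apply: cvgMl; apply: cvgMr; exact: phi_cvg.
apply: (@le_trans _ _ ((\sum_(x <- Sf) psi x ^+ 2 * u x * (m x * f x)) + 2)).
  apply: (ler_cvg_to A_lim T_lim); exists (maxn N0 N1) => // n /=.
  rewrite geq_max => /andP[Nn0 Nn1].
  have [s Es] : exists s, [set x | phi n x != 0] = [set` s].
    by apply/finite_seqP; exact: phi_fin.
  have Hs x : phi n x != 0 -> x \in s.
    by move=> p0; suff : [set` s] x by []; rewrite -Es.
  pose S := hull s.
  have uS : uniq S by exact: hull_uniq.
  have Lg x : phi n x != 0 -> 0 <= lap b S (fun y => g y ^+ 2) x.
    by move=> /Hs xs; rewrite lap_hull.
  have := agmon_form b0 bs g_gt0 psi_ge0 psi_le eikonal u al01 d0 Lg.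
  have -> : \sum_(x <- S) psi x ^+ 2 * phi n x * lap b S u x =
      \sum_(x <- Sf) psi x ^+ 2 * phi n x * (m x * f x).
    transitivity (\sum_(x <- S) psi x ^+ 2 * phi n x * (m x * f x)).
      apply: eq_bigr => x _.
      have [->|/Hs xs] := eqVneq (phi n x) 0; first by rewrite !(mulr0, mul0r).
      by rewrite lap_hull // mop_formal_op u_sol.
    apply: eq_sum_support => // x; rewrite !mulf_eq0 !negb_or.
      by case/andP=> /andP[_ /Hs /sub_hull].
    by case/and3P=> _ _ /Sf_supp.
  have AH : A n <= (1 - al ^+ 2) *
      (\sum_(x <- S) (phi n x * psi x) ^+ 2 / g x * lap b S g x).
    apply: ler_wpM2l; first by case/andP: al01 => *; nra.
    apply: (@weight_seq_le F S (fun x => phi n x * psi x)) => // x.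
    rewrite !mulf_eq0 !negb_or => /andP[/Hs xs _].
    by split; [exact: sub_hull|exact: lap_hull].
  move=> H; apply: le_trans AH (le_trans H _).
  rewrite /T -addrA lerD2l.
  have h1 : d^-1 * edge_sum b S (dsq (fun x => phi n x - u x)) <= 1.
    by rewrite mulrC ler_pdivrMr // mul1r HD.
  have h2 : d * (12 * M ^+ 4 * edge_sum b S (dsq (phi n))) <= 1.
    rewrite /d mulrC ler_pdivrMr ?mul1r; last by rewrite ltr_pwDr // mulr_ge0.
    by rewrite ler_wpDr // ler_wpM2l // HB.
  by have := lerD h1 h2; rewrite -(natrD _ 1 1).
rewrite lerD2r; apply: ler_sum => x _.
apply: le_trans (ler_norm _) _.
rewrite (normrM (_ * _)) (normrM _ (u x)) (normrM (m x)) (gtr0_norm (m_gt0 x)).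
by rewrite (ger0_norm (sqr_ge0 _)) (mulrC (m x)) (mulrC (psi x ^+ 2)).
Qed.

End Weighted.
End Linking.

(** * Truncation of [v] and conclusion *)

Lemma mop_min_ge0 (R : realType) (X : countType) (b : X -> X -> R)
    (v : X -> R) (K : R) (x : X) :
  (forall x y, 0 <= b x y) -> 0 <= mop b v x ->
  0 <= mop b (fun y => Num.min (v y) K) x.
Proof.
(* If [v x <= K], truncation keeps the value at [x] and can only lower the others; otherwise the
   value at [x] is the maximal one, [K], so every difference is nonnegative. *)
move=> b0 vx; case: (leP (v x) K) => vK.
  apply: le_trans vx _; apply: ler_sum => y _; rewrite ler_wpM2l //.
  by rewrite (min_idPl vK) lerB // ge_min lexx.
apply: sumr_ge0 => y _; rewrite mulr_ge0 // subr_ge0 (min_idPr (ltW vK)).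
by rewrite ge_min lexx orbT.
Qed.

Lemma powR_half_sqr (R : realType) (x a : R) : 0 <= x ->
  ((x `^ 2^-1) `^ a) ^+ 2 = x `^ a.
Proof.
move=> x0; rewrite -powR_mulrn ?powR_ge0 // -!powRrM; congr (_ `^ _).
by field.
Qed.

Theorem theorem4p7 (R : realType) (X : countType) (m : X -> R)
    (b : X -> X -> R) (v f u : X -> R)
    (X_infinite : infinite_set [set: X])
    (m_gt0 : forall x, 0 < m x)
    (b_graph : is_graph b)
    (b_locally_finite : locally_finite b)
    (v_gt0 : forall x, 0 < v x)
    (v_superharmonic : superharmonic m b v)
    (v_oscillation : bounded_oscillation b v)
    (f_finite : finitely_supported f)
    (u_hyp : (approximable m b u /\
               (solution m b f u \/
                (forall x, 0 <= u x) /\ subsolution m b f u)) \/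
             (dom_H m b u /\ solution m b f u)) :
  forall alpha : R, 0 < alpha < 1 ->
    ell2 (fun x => v x `^ alpha * hardy_weight m b v x * m x) u.
Proof.
move=> al al01.
have [s Es] : exists s : seq X, [set x | f x != 0] = [set` s].
  by apply/finite_seqP; exact: f_finite.
pose Sf := undup s.
have Sf_uniq : uniq Sf by exact: undup_uniq.
have Sf_supp x : f x != 0 -> x \in Sf.
  by move=> p0; rewrite mem_undup; suff : [set` s] x by []; rewrite -Es.
have a2 : 0 < 1 - al ^+ 2 by case/andP: al01 => *; nra.
(* One bound for both cases. It is quantified over [g] and [psi], since the truncation will depend
   on [F]; neither [c] nor the right side involves [M]. *)
have [c c0 agmon] : exists2 c : R, 0 < c &
    forall (g psi : X -> R) (M : R) (F : seq X),
      (forall x, 0 < g x) -> (forall x, 0 <= mop b (fun y => g y ^+ 2) x) ->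
      (forall x, 0 <= psi x) -> (forall x, psi x <= M) ->
      (forall x y, dsq psi x y * (g x * g y) <=
         al ^+ 2 * (psi x * psi y * dsq g x y)) -> uniq F ->
      c * (\sum_(x <- F) (u x * psi x) ^+ 2 / g x * mop b g x) <=
      \sum_(x <- Sf) `|u x| * psi x ^+ 2 * (`|f x| * m x) + 2.
  case: u_hyp => [[u_app u_sol]|[[h [u_dom _ _]] u_sol]].
    exists ((1 - al ^+ 2) ^+ 2) => [|g psi M F *]; first exact: exprn_gt0.
    apply: (@le_trans _ _
        (\sum_(x <- Sf) `|u x| * psi x ^+ 2 * (`|f x| * m x) + 1)).
      exact: (@agmon_approximable _ _ m b m_gt0 b_graph b_locally_finite
        f u g psi al M).
    by rewrite lerD2l ler1n.
  exists (1 - al ^+ 2) => // g psi M F *.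
  exact: (@agmon_closure _ _ m b m_gt0 b_graph b_locally_finite
    f u g psi al M).
pose C := c^-1 * (\sum_(x <- Sf) `|u x| * v x `^ al * (`|f x| * m x) + 2).
rewrite /ell2; apply: (@le_lt_trans _ _ C%:E); last exact: ltry.
apply: esum_le_seq => F uF; rewrite sumEFin lee_fin.
(* With this [K], truncation does not change [v] near [F]. *)
pose K := 1 + \sum_(x <- hull b F) v x.
have K0 : 0 < K.
  by rewrite ltr_pwDl // sumr_ge0 // => x _; exact: ltW.
have vK x : x \in hull b F -> Num.min (v x) K = v x.
  move=> xF; apply/min_idPl; rewrite /K (big_rem x xF) /= addrCA lerDl.
  by rewrite addr_ge0 // sumr_ge0 // => y _; exact: ltW.
pose vt x := Num.min (v x) K.
have vt0 x : 0 < vt x by rewrite lt_min v_gt0.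
pose g x := vt x `^ 2^-1; pose psi x := g x `^ al.
have g2 x : g x ^+ 2 = vt x by rewrite /g powR12_sqrt ?sqr_sqrtr // ltW.
have psi2 x : psi x ^+ 2 = vt x `^ al by rewrite powR_half_sqr // ltW.
have al0 : 0 <= al by case/andP: al01 => /ltW.
have g0 x : 0 < g x by exact: powR_gt0.
have g_super x : 0 <= mop b (fun y => g y ^+ 2) x.
  have -> : (fun y => g y ^+ 2) = vt by apply/funext.
  apply: mop_min_ge0; first exact: graph_ge0.
  rewrite (mop_formal_op m_gt0 b_graph b_locally_finite).
  by rewrite mulr_ge0 ?(ltW (m_gt0 x)) //; case: v_superharmonic.
(* Truncation supplies the upper bound [M] on [psi], which [v] itself need not give. *)
have psi_le x : psi x <= (K `^ 2^-1) `^ al.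
  apply: ge0_ler_powR; rewrite ?nnegrE ?powR_ge0 //.
  apply: ge0_ler_powR; rewrite ?nnegrE ?invr_ge0 ?(ltW (vt0 x)) ?(ltW K0) //.
  by rewrite ge_min lexx orbT.
have := agmon g psi _ F g0 g_super (fun x => powR_ge0 _ _) psi_le
  (fun x y => eikonal_powR al01 (g0 x) (g0 y)) uF.
(* In the source term the truncation is replaced by the larger [v], which makes the bound [C]
   independent of [F]. *)
rewrite -ler_pdivlMl // => H; apply: le_trans (le_trans H _); last first.
  rewrite ler_wpM2l ?invr_ge0 ?(ltW c0) // lerD2r; apply: ler_sum => x _.
  rewrite psi2 ler_wpM2r ?mulr_ge0 ?(ltW (m_gt0 x)) // ler_wpM2l //.
  apply: ge0_ler_powR;
    by rewrite ?nnegrE ?(ltW (vt0 x)) ?(ltW (v_gt0 x)) // ge_min lexx.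
(* On [F] nothing was changed by truncation: [mop] at a point of [F] only sees values on
   [hull b F]. *)
rewrite le_eqVlt; apply/orP; left; apply/eqP.
apply: eq_big_seq => x xF.
have gx y : y \in hull b F -> g y = v y `^ 2^-1 by rewrite /g /vt => /vK ->.
have xH : x \in hull b F by exact: sub_hull.
have -> : mop b g x = mop b (fun y => v y `^ 2^-1) x.
  apply: eq_big_seq => y xy.
  by rewrite (gx x xH) (gx y (nbr_hull xF xy)).
rewrite (mop_formal_op m_gt0 b_graph b_locally_finite).
rewrite exprMn psi2 /vt vK // gx //.
by rewrite /hardy_weight; ring.
Qed.
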